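(* In the anti-OK Corral model with $n$ balls of each type, for each fixed integer $k\ge1$, as $n\to\infty$, the probability that a specified player, say Player 1, wins overall with net profit $k$ (that is, Player 1 is the first to win $n$ rounds and at that time the other player has won exactly $n-k\in\{0,1,\dots,n-1\}$ rounds) converges to $\frac{1}{2^{k+1}}$. As a result, as $n\to\infty$ the (signed) net profit of a given player converges in distribution to the equal-weight mixture (weights $1/2$ and $1/2$) of the law of $G$ and the law of $-G$, where $G$ is a Geometric$(1/2)$ random variable supported on the positive integers, $\mathbb{P}(G=k)=2^{-k}$ for $k\ge1$.
   Context: Anti-OK Corral model: an urn initially contains $n$ balls of type 1 and $n$ balls of type 2. In each round a ball is drawn uniformly at random from the urn without replacement; if it is of type $i$, Player $i$ wins the round ($i=1,2$). The player who first wins $n$ rounds (i.e. first has all $n$ balls of their type drawn) is the overall winner, and the game stops. If the losing player has won $W$ rounds at that time, the net profit of the winner is $n-W$ and the net profit of the loser is $-(n-W)$. *)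

(* Defs.v *)
From HB Require Import structures.
From mathcomp Require Import all_boot all_order all_algebra.
From mathcomp Require Import all_classical all_reals all_analysis.

Set Implicit Arguments.
Unset Strict Implicit.
Unset Printing Implicit Defensive.
Import Order.TTheory GRing.Theory Num.Theory.
Import numFieldNormedType.Exports.
Local Open Scope classical_set_scope.
Local Open Scope ring_scope.

(* Players, and ball types, are booleans: [true] is Player 1, [false] is
   Player 2.  The ball [(i, j)] is the [j]-th ball of type [i]. *)
Notation urnball := (bool * nat)%type.

Definition urn (n : nat) : seq urnball :=
  [seq (i, j) | i <- [:: true; false], j <- iota 0 n].

(* A history is the list of the balls drawn so far, oldest first. *)
Definition remaining (n : nat) (h : seq urnball) : seq urnball :=
  [seq b <- urn n | b \notin h].

Definition wins (i : bool) (h : seq urnball) : nat :=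
  count (fun b => b.1 == i) h.

Definition game_over (n : nat) (h : seq urnball) : bool :=
  (n <= wins true h)%N || (n <= wins false h)%N.

Lemma game_over_ex (n : nat) (x : nat -> urnball) :
  exists t, game_over n (mkseq x t).
Proof.
exists (n + n)%N; rewrite /game_over.
have E (h : seq urnball) : (wins true h + wins false h = size h)%N.
  rewrite -(count_predC (fun b : urnball => b.1 == true) h) /wins; congr addn.
  by apply: eq_count => -[[] j].
have := E (mkseq x (n + n)); rewrite size_mkseq => {}E.
case: leqP => //= h1; rewrite leqNgt; apply/negP => h2.
by have := leq_add h1 (ltnW h2); rewrite addSn E ltnn.
Qed.

(* [x t] is the ball drawn in round [t.+1]; [play n x] is the history at the
   first time some player has won [n] rounds, which is when the game stops, so
   later values of [x] are ignored. *)
Definition duration (n : nat) (x : nat -> urnball) : nat :=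
  ex_minn (game_over_ex n x).

Definition play (n : nat) (x : nat -> urnball) : seq urnball :=
  mkseq x (duration n x).

Lemma play_eq (n : nat) (x y : nat -> urnball) :
  mkseq y (size (play n x)) = play n x -> play n y = play n x.
Proof.
rewrite /play size_mkseq => e; rewrite -e; congr mkseq.
rewrite /duration; case: ex_minnP => s ys smin.
move: e; rewrite /duration; case: ex_minnP => t xt tmin e.
have eqt u : (u <= t)%N -> mkseq y u = mkseq x u.
  move=> ut; move: (congr1 (take u) e).
  by rewrite /mkseq -!map_take !take_iota (minn_idPl ut).
apply/eqP; rewrite eqn_leq smin ?e //=; case: leqP => // st.
by have := tmin s; rewrite -eqt ?(ltnW st) // ys leqNgt st => /(_ isT).
Qed.

Definition overall_winner (n : nat) (x : nat -> urnball) (i : bool) : bool :=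
  wins i (play n x) == n.

Definition net_profit (n : nat) (x : nat -> urnball) (i : bool) : int :=
  if overall_winner n x i then n%:Z - (wins (~~ i) (play n x))%:Z
  else - (n%:Z - (wins i (play n x))%:Z).

Section model.
Context {d : measure_display} {T : measurableType d} {R : realType}.
Variables (P : probability T R) (X : nat -> {RV P >-> urnball}).

Definition drawn (h : seq urnball) : set T :=
  [set w | mkseq (fun t => X t w) (size h) = h].

(* Drawing without replacement: as long as the game is not over after the
   history [h], the conditional law of the next ball given [h] is uniform on the
   balls left in the urn.  Nothing is required of the draws after the game. *)
Definition anti_ok_corral (n : nat) : Prop :=
  forall (h : seq urnball) (b : urnball), ~~ game_over n h ->
  P (drawn (rcons h b)) =
  (P (drawn h) *
   (if b \in remaining n h then (size (remaining n h))%:R^-1 else 0)%:E)%E.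

Definition profit (n : nat) (i : bool) (w : T) : R :=
  (net_profit n (fun t => X t w) i)%:~R.

Lemma measurable_drawn (h : seq urnball) : measurable (drawn h).
Proof.
have m1 (b : urnball) t : measurable (X t @^-1` [set b]).
  have -> : [set b] = [set b.1] `*` [set b.2].
    by apply/seteqP; case: b => i j; split=> -[i' j'] /= [-> ->].
  rewrite -[_ @^-1` _]setTI; apply: measurable_funP => //.
  exact: measurableX.
elim/last_ind: h => [|h b IH].
  by rewrite (_ : drawn _ = setT) //; apply/seteqP; split.
rewrite (_ : drawn _ = drawn h `&` X (size h) @^-1` [set b]).
  exact: measurableI.
apply/seteqP; split=> w; rewrite /drawn /= size_rcons mkseqS.
  by move=> /rcons_inj[-> ->].
by move=> [-> ->].
Qed.

Lemma measurable_profit (n : nat) (i : bool) :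
  measurable_fun [set: T] (profit n i).
Proof.
move=> _ A _; rewrite setTI.
rewrite (_ : _ @^-1` _ =
    \bigcup_(h in [set h | drawn h `<=` profit n i @^-1` A]) drawn h).
  rewrite bigcup_mkcond; apply: countable_bigcupT_measurable => [|h].
    exact: countableP.
  by case: ifP => // _; exact: measurable_drawn.
apply/seteqP; split=> w /=; last by move=> [h /= hA /hA].
move=> Aw; exists (play n (fun t => X t w)) => [w'|]; last first.
  by rewrite /drawn /= size_mkseq.
move=> /play_eq e; move: Aw.
by rewrite /= /profit /net_profit /overall_winner e.
Qed.

HB.instance Definition _ (n : nat) (i : bool) :=
  isMeasurableFun.Build _ _ T R (profit n i) (measurable_profit n i).

End model.

Section mixture.
Context {d : measure_display} {T : measurableType d} {R : realType}.
Variables mu nu : probability T R.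

(* weights 1/2 and 1/2 *)
Definition half_mixture : set T -> \bar R :=
  measure_add (mscale (2^-1)%:nng mu) (mscale (2^-1)%:nng nu).

HB.instance Definition _ := Measure.on half_mixture.

Let half_mixture_setT : half_mixture setT = 1%E.
Proof.
have mu1 : mu setT = 1%E by exact: probability_setT.
have nu1 : nu setT = 1%E by exact: probability_setT.
rewrite /half_mixture measure_addE /= /mscale /= mu1 nu1 !mule1 -EFinD.
by rewrite -mulr2n -mulr_natl mulfV // pnatr_eq0.
Qed.

HB.instance Definition _ :=
  Measure_isProbability.Build _ _ _ half_mixture half_mixture_setT.

End mixture.

(* Convergence in distribution of laws on the real line: convergence of the
   cumulative distribution functions at continuity points of the limit. *)
Definition cvg_in_distribution {R : realType}
    (mu : nat -> probability R R) (nu : probability R R) : Prop :=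
  forall x : R, {for x, continuous (fun y : R => nu `]-oo, y]%classic)} ->
  mu n `]-oo, x]%classic @[n --> \oo] --> nu `]-oo, x]%classic.

(* Main.v *)
(* Condition on the balls drawn so far: the chance that player i still wins with
   profit k depends only on the numbers a and b of balls left of the two types,
   and solves a recursion whose solution is the number of favourable orders of
   types divided by 'C(a + b, a).  From the initial urn this is
   'C(2n - k - 1, n - 1) / 'C(2n, n), and the ratio of consecutive values in k is
   (n - k) / (2n - k - 1), which tends to 1/2.  Since the losing player's profit
   is the opposite of the winner's, all point masses of the profit converge to
   those of the limit law; the latter have total mass 1, so no mass escapes and
   the probabilities of all measurable sets converge. *)
Require Import Defs.
From HB Require Import structures.
From mathcomp Require Import all_boot all_order all_algebra.
From mathcomp Require Import all_classical all_reals all_analysis.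
From mathcomp Require Import measurable_realfun.
From mathcomp Require Import zify ring lra.
Import Order.TTheory GRing.Theory Num.Theory.
Import numFieldNormedType.Exports.
Local Open Scope classical_set_scope.
Local Open Scope ring_scope.

(** * Histories, the end of the game, and the winner *)

Lemma wins_rcons (c : bool) (h : seq urnball) (b : urnball) :
  wins c (rcons h b) = (wins c h + (b.1 == c))%N.
Proof. by rewrite /wins -cats1 count_cat /= addn0. Qed.

Lemma winsD (c : bool) (h : seq urnball) :
  (wins c h + wins (~~ c) h = size h)%N.
Proof.
rewrite -(count_predC (fun b : urnball => b.1 == c) h) /wins; congr addn.
by apply: eq_count => -[[] j]; case: c.
Qed.

Lemma take_mkseq (U : Type) (x : nat -> U) (s t : nat) :
  (s <= t)%N -> take s (mkseq x t) = mkseq x s.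
Proof. by move=> st; rewrite /mkseq -map_take take_iota (minn_idPl st). Qed.

Lemma game_over_mkseq (n : nat) (x : nat -> urnball) (s t : nat) :
  (s <= t)%N -> game_over n (mkseq x s) -> game_over n (mkseq x t).
Proof.
move=> st; rewrite -(take_mkseq _ x _ _ st) -{2}(cat_take_drop s (mkseq x t)).
rewrite /game_over /wins !count_cat => /orP[] h; apply/orP; [left|right];
  exact: leq_trans h (leq_addr _ _).
Qed.

(** Being over persists when more balls are drawn, so the game cannot have stopped before the last
    ball of [h]; [take (size h).-1 h] is [h] without that ball. *)
Lemma play_drawn (n : nat) (x : nat -> urnball) (h : seq urnball) :
  ~~ game_over n (take (size h).-1 h) -> game_over n h ->
  mkseq x (size h) = h -> play n x = h.
Proof.
move=> h0 h1 xh; rewrite /play /duration; case: ex_minnP => t xt tmin.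
have := tmin (size h); rewrite xh => /(_ h1); rewrite leq_eqVlt.
case/predU1P=> [->//|tlt]; move: h0.
rewrite -{2}xh take_mkseq ?leq_pred// (game_over_mkseq _ _ t)//.
by rewrite -ltnS prednK// (leq_ltn_trans _ tlt).
Qed.

(** One round before the end neither player has [n] wins, and the last ball raises only one count;
    [0 < n] ensures that there is a last ball. *)
Lemma play_winner (n : nat) (x : nat -> urnball) : (0 < n)%N ->
  exists c, wins c (play n x) = n /\ (wins (~~ c) (play n x) < n)%N.
Proof.
move=> n0; rewrite /play /duration; case: ex_minnP => -[|t] xt tmin.
  by move: xt; rewrite /game_over /= leqNgt n0.
have : ~~ game_over n (mkseq x t) by apply/negP => /tmin; rewrite ltnn.
move: xt; rewrite /game_over mkseqS => xt nt; exists (x t).1; move: xt nt.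
by rewrite !wins_rcons; case: (x t).1; rewrite /= ?eqxx /=; lia.
Qed.

Lemma overall_winnerN (n : nat) (x : nat -> urnball) (i : bool) : (0 < n)%N ->
  overall_winner n x (~~ i) = ~~ overall_winner n x i.
Proof.
move=> n0; have [c [cn cNn]] := play_winner n x n0; rewrite /overall_winner.
by move: i c cn cNn => [] [] /= -> /ltn_eqF ->; rewrite eqxx.
Qed.

Lemma net_profitN (n : nat) (x : nat -> urnball) (i : bool) : (0 < n)%N ->
  net_profit n x (~~ i) = - net_profit n x i.
Proof.
move=> n0; rewrite /net_profit overall_winnerN// negbK.
by case: overall_winner; rewrite //= opprK.
Qed.

(** The loser's profit is negative, so the sign of the profit reveals the winner. *)
Lemma net_profit_pos_winner (n : nat) (x : nat -> urnball) (i : bool) (k : nat) :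
  (0 < n)%N -> (0 < k)%N -> net_profit n x i = k%:Z -> overall_winner n x i.
Proof.
move=> n0 k0; have [c [cn cNn]] := play_winner n x n0.
rewrite /net_profit /overall_winner.
by move: i c cn cNn => [] [] /= -> /[dup] /ltn_eqF e; rewrite ?e ?eqxx//; lia.
Qed.

Lemma game_over_size (n : nat) (h : seq urnball) :
  (n + n <= size h)%N -> game_over n h.
Proof. by rewrite /game_over -(winsD true h) /=; lia. Qed.

(** * Counting the balls left in the urn *)

Section remaining_balls.
Variables (n : nat) (h : seq urnball).
Hypotheses (uh : uniq h) (hn : all (fun b => b.2 < n)%N h).

(** As [h] has no repetition and only legal indices, its balls of type [c] correspond one to one to
    the drawn indices below [n]. *)
Lemma count_undrawn (c : bool) :
  (count (fun j => (c, j) \notin h) (iota 0 n) + wins c h)%N = n.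
Proof.
suff -> : wins c h = count (fun j => (c, j) \in h) (iota 0 n).
  by rewrite addnC count_predC size_iota.
rewrite /wins -!size_filter -[RHS](size_map (pair c)); apply: perm_size.
apply: uniq_perm; rewrite ?filter_uniq//.
  by rewrite map_inj_uniq ?filter_uniq ?iota_uniq// => j j' [].
move=> [c' j]; rewrite mem_filter /=; apply/andP/mapP.
  move=> [/eqP -> cjh]; exists j => //.
  by rewrite mem_filter cjh mem_iota /= add0n (allP hn _ cjh).
by move=> [j' + [-> ->]]; rewrite mem_filter eqxx => /andP[].
Qed.

Lemma size_remaining :
  (size (remaining n h) + size h = n + n)%N.
Proof.
rewrite -(winsD true h) /remaining /urn /= cats0 filter_cat size_cat.
rewrite !filter_map !size_map !size_filter /=.
by rewrite addnACA !count_undrawn.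
Qed.

Lemma mem_remaining (b : urnball) :
  (b \in remaining n h) = (b \notin h) && (b.2 < n)%N.
Proof.
rewrite mem_filter; congr andb; case: b => c j; apply/allpairsP/idP => /=.
  by move=> [[c' j']] /= [_ + [_ ->]]; rewrite mem_iota add0n.
by move=> jn; exists (c, j); rewrite mem_iota add0n jn; split => //; case: (c).
Qed.

End remaining_balls.

(** * The recursion for the winning probability *)

(* The number of orders of types in which the remaining [a] balls of the winner
   and [b] balls of the loser can be drawn so that the winner finishes when
   exactly [k] balls of the loser are left. *)
Definition win_paths (k a b : nat) : nat :=
  if (b < k)%N then 0%N else if a is a'.+1 then 'C(a' + (b - k), a')
  else (b == k).

(** Classify the orders by the type of their first ball. For [k <= b] and [a > 0] this is Pascal's
    rule; for [b.+1 = k] the only order draws all of the winner's balls first. *)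
Lemma win_pathsS (k a b : nat) : (0 < k)%N ->
  (win_paths k a.+1 b.+1 = win_paths k a b.+1 + win_paths k a.+1 b)%N.
Proof.
move=> k0; rewrite /win_paths; case: ltnP => [bk|].
  by rewrite (ltn_trans (ltnSn b) bk).
rewrite leq_eqVlt => /predU1P[->|kb].
  rewrite ltnSn subnn addn0 binn addn0; case: a => [|a]; first by rewrite eqxx.
  by rewrite addn0 binn.
rewrite ltnNge -ltnS kb /=; case: a => [|a].
  by rewrite !bin0 gtn_eqF.
by rewrite subSn// addSn binS addnC addnS addSn.
Qed.

Definition win_prob {R : realType} (k a b : nat) : R :=
  (win_paths k a b)%:R / 'C(a + b, a)%:R.

Lemma win_probS {R : realType} (k a b : nat) : (0 < k)%N ->
  win_prob k a.+1 b.+1 =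
  a.+1%:R / (a.+1 + b.+1)%:R * win_prob k a b.+1 +
  b.+1%:R / (a.+1 + b.+1)%:R * win_prob k a.+1 b :> R.
Proof.
move=> k0; rewrite /win_prob win_pathsS// natrD.
have C0 m l : 'C(m + l, m)%:R != 0 :> R.
  by rewrite pnatr_eq0 -lt0n bin_gt0 leq_addr.
(* The absorption identities turn the common denominator into those of the two urns with one ball
   fewer, at the price of the drawing probabilities. *)
have eA : a.+1%:R * 'C(a.+1 + b.+1, a.+1)%:R =
    (a.+1 + b.+1)%:R * 'C(a + b.+1, a)%:R :> R.
  by rewrite -!natrM -mul_bin_diag.
have eB : b.+1%:R * 'C(a.+1 + b.+1, a.+1)%:R =
    (a.+1 + b.+1)%:R * 'C(a.+1 + b, a.+1)%:R :> R.
  by have := mul_bin_down (a.+1 + b.+1) a.+1; rewrite addKn addnS -!natrM => <-.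
have S0 : (a.+1 + b.+1)%:R != 0 :> R by rewrite pnatr_eq0.
rewrite mulrDl; congr +%R.
  rewrite [RHS]mulrACA -invfM -eA invfM mulrACA mulfV ?mul1r// pnatr_eq0//.
rewrite [RHS]mulrACA -invfM -eB invfM mulrACA mulfV ?mul1r// pnatr_eq0//.
Qed.

Lemma win_prob_drawn {R : realType} (n k u v : nat) :
  (0 < k)%N -> (u < n)%N -> (v < n)%N ->
  win_prob k (n - u) (n - v) =
  (n - u)%:R / (n + n - (u + v))%:R * win_prob k (n - u.+1) (n - v) +
  (n - v)%:R / (n + n - (u + v))%:R * win_prob k (n - u) (n - v.+1) :> R.
Proof.
move=> k0 un vn; rewrite -(subnSK un) -(subnSK vn).
have -> : (n + n - (u + v) = (n - u.+1).+1 + (n - v.+1).+1)%N by lia.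
exact: win_probS.
Qed.

(** * The limit of the winning probability *)

Lemma cvg_half_ratio {R : realType} (k : nat) :
  ((m.+1)%:R / (m + m + k).+1%:R : R) @[m --> \oo] --> (2^-1 : R).
Proof.
(* For [n = m + k + 1] this is the ratio [(n - k) / (2n - k - 1)], split into its limit and a term
   of order [1 / m]. *)
have E m : (m.+1)%:R / (m + m + k).+1%:R =
    2^-1 + (1 - k%:R) / 2 * (m + m + k).+1%:R^-1 :> R.
  have : (m + m + k).+1%:R != 0 :> R by rewrite pnatr_eq0.
  rewrite -!natr1 !natrD; set x : R := m%:R; set y : R := k%:R => h.
  by field.
rewrite (funext E) -[X in _ --> X]addr0; apply: cvgD; first exact: cvg_cst.
rewrite -[X in _ --> X](mulr0 ((1 - k%:R) / 2)); apply: cvgM.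
  exact: cvg_cst.
apply: (@squeeze_cvgr _ _ _ _ (fun=> 0) harmonic).
- near=> m; rewrite invr_ge0 ler0n /harmonic /= lef_pV2 ?posrE ?ltr0n//.
  by rewrite ler_nat; lia.
- exact: cvg_cst.
- exact: cvg_harmonic.
Unshelve. all: by end_near. Qed.

(** Induction on [k]. The value at [k = 0] is not the probability of any profit, but it is exactly
    1/2 for [n > 0] and starts the induction; each step multiplies by a ratio that tends to 1/2. *)
Lemma cvg_win_prob {R : realType} (k : nat) :
  (win_prob k n n : R) @[n --> \oo] --> ((2%:R ^+ k.+1)^-1 : R).
Proof.
rewrite -cvg_shiftS /=; elim: k => [|k IH].
  rewrite expr1; apply: cvg_near_cst; near=> n.
  rewrite /win_prob /win_paths subn0.
  have := mul_bin_diag (n.+1 + n.+1) n; rewrite /= addSn /=.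
  move=> /(congr1 (fun m => m%:R : R)); rewrite !natrM -addSn.
  have C0 : 'C(n.+1 + n.+1, n.+1)%:R != 0 :> R.
    by rewrite pnatr_eq0 -lt0n bin_gt0 leq_addr.
  rewrite natrD => E; apply: (mulIf C0); rewrite divfK//.
  apply: (mulfI (_ : n.+1%:R != 0 :> R)); first by rewrite pnatr_eq0.
  by rewrite mulrCA -E; field.
(* With the urn size written as [m + k + 1], the differences with [k] in the binomials become
   sums. *)
rewrite -(cvg_shiftn k) /=.
move: IH; rewrite -(cvg_shiftn k) /= => IH.
rewrite exprSr invfM.
apply: cvg_trans (cvgM IH (cvg_half_ratio k)); apply: near_eq_cvg; near=> m.
rewrite /= /win_prob mulrAC /win_paths; congr (_ / _).
have [-> ->] : ((m + k).+1 < k)%N = false /\ ((m + k).+1 < k.+1)%N = false by lia.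
rewrite subSS -addSn !addnK.
(* This relates the numerators for [k.+1] and [k]: [(2m + k + 1) 'C(2m + k, m + k) = (m + 1) 'C(2m +
   k + 1, m + k)]. *)
have := mul_bin_down (m + k + m.+1) (m + k).
rewrite addKn addnS /= => /(congr1 (fun m => m%:R : R)); rewrite !natrM.
rewrite (_ : m + k + m = m + m + k)%N; last by rewrite addnAC.
move=> E; rewrite mulrA [X in X / _]mulrC -E mulrC mulKf// pnatr_eq0//.
Unshelve. all: by end_near. Qed.

(** * The exact winning probability, by conditioning on the history *)

Section one_urn.
Context {d : measure_display} {T : measurableType d} {R : realType}.
Variables (P : probability T R) (X : nat -> {RV P >-> urnball}) (n : nat).
Hypotheses (hX : anti_ok_corral X n) (n0 : (0 < n)%N).
Variables (i : bool) (k : nat).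
Hypothesis k0 : (0 < k)%N.

Definition win_event : set T :=
  [set w | overall_winner n (fun t => X t w) i /\
           net_profit n (fun t => X t w) i = k%:Z].

(** A profit of [k > 0] already implies winning, so the event is a fibre of the random variable
    [profit]. This gives its measurability and links the two claims of the theorem. *)
Lemma win_eventE : win_event = profit X n i @^-1` [set k%:R].
Proof.
apply/seteqP; split=> w; rewrite /win_event /profit /=; first by move=> [_ ->].
rewrite [in X in _ = X]pmulrn => /eqP; rewrite eqr_int => /eqP e.
by split => //; exact: net_profit_pos_winner e.
Qed.

Lemma measurable_win_event : measurable win_event.
Proof.
rewrite win_eventE -[_ @^-1` _]setTI; apply: measurable_profit => //.
Qed.

Lemma drawn_rcons (h : seq urnball) (b : urnball) :
  drawn X (rcons h b) = drawn X h `&` [set w | X (size h) w = b].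
Proof.
apply/seteqP; split=> w; rewrite /drawn /= size_rcons mkseqS.
  by move=> /rcons_inj[-> ->].
by move=> [-> ->].
Qed.

(* Only the [n] balls of type [c] contribute: any other has probability 0. *)
Lemma prob_next (h : seq urnball) (c : bool) (A : set T) (q : R) :
  ~~ game_over n h -> uniq h -> all (fun b => b.2 < n)%N h -> measurable A ->
  (forall j, (c, j) \in remaining n h ->
    P (drawn X (rcons h (c, j)) `&` A) =
    (P (drawn X (rcons h (c, j))) * q%:E)%E) ->
  P (drawn X h `&` [set w | (X (size h) w).1 = c] `&` A) =
  (P (drawn X h) *
   ((n - wins c h)%:R / (n + n - size h)%:R * q)%:E)%E.
Proof.
move=> hno uh hn mA hq.
(* The values of [X] may have any natural index, so the event is first a countable disjoint union;
   indices from [n] on and balls already drawn then give null events. *)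
have -> : drawn X h `&` [set w | (X (size h) w).1 = c] `&` A =
    \bigcup_j (drawn X (rcons h (c, j)) `&` A).
  apply/seteqP; split=> [w [[hw cw] Aw]|w [j _]].
    exists (X (size h) w).2 => //; split => //.
    by rewrite drawn_rcons; split => //=; rewrite -cw; case: (X _ _).
  by rewrite drawn_rcons => -[[hw /= ->] Aw].
have mD j : measurable (drawn X (rcons h (c, j)) `&` A).
  by apply: measurableI => //; exact: measurable_drawn.
rewrite measure_bigcup//; last first.
  move=> j j' _ _ [w [[]]]; rewrite !drawn_rcons => -[_ /= ->] _ [[_ /=]].
  by move=> [].
rewrite (eq_eseriesl (Q := xpredT)); last by move=> j; exact: in_setT.
have D0 j : (c, j) \notin remaining n h -> P (drawn X (rcons h (c, j)) `&` A) = 0%E.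
  move=> /negPf cj; apply/eqP; rewrite eq_le measure_ge0 andbT.
  rewrite (@le_trans _ _ (P (drawn X (rcons h (c, j)))))//.
    by rewrite le_measure ?inE//; exact: measurable_drawn.
  by rewrite hX// cj mule0.
rewrite (nneseries_split 0%N n)// add0n eseries0 ?adde0; last first.
  by move=> j nj _; apply: D0; rewrite mem_remaining// ltnNge nj andbF.
have rE j : (c, j) \in remaining n h ->
    P (drawn X (rcons h (c, j)) `&` A) =
    (P (drawn X h) * ((n + n - size h)%:R^-1 * q)%:E)%E.
  move=> cj; rewrite hq// hX// cj -muleA -EFinM.
  by rewrite -(size_remaining n h uh hn) addnK.
rewrite (bigID (fun j => (c, j) \in remaining n h)) /= [X in (_ + X)%E]big1 ?adde0; last first.
  exact: D0.
rewrite (eq_bigr _ rE).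
rewrite -[P (drawn X h)]fineK ?fin_num_measure//; last exact: measurable_drawn.
(* All surviving terms are equal; it remains to count the undrawn balls of type [c]. *)
rewrite -EFinM sumEFin big_const_seq iter_addr_0 -EFinM; congr EFin.
rewrite (eq_in_count (a2 := fun j => (c, j) \notin h)); last first.
  by move=> j; rewrite mem_index_iota mem_remaining => /= ->; rewrite andbT.
have -> : (n - wins c h = count (fun j => (c, j) \notin h) (iota 0 n))%N.
  by rewrite -[X in (X - _)%N](count_undrawn _ _ uh hn c) addnK.
rewrite /index_iota subn0.
by rewrite -mulr_natl; ring.
Qed.

(** Once the game has ended with [h], the outcome is determined: the event contains [drawn X h] or
    is disjoint from it, and [win_prob] takes its boundary value 1 or 0. *)
Lemma win_event_over (h : seq urnball) :
  uniq h -> all (fun b => b.2 < n)%N h ->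
  ~~ game_over n (take (size h).-1 h) -> game_over n h ->
  P (drawn X h `&` win_event) =
  (P (drawn X h) * (win_prob k (n - wins i h) (n - wins (~~ i) h))%:E)%E.
Proof.
move=> uh hn hno ho.
have wn c : (wins c h <= n)%N.
  by rewrite -[leqRHS](count_undrawn _ _ uh hn c) leq_addl.
have E w : drawn X h w ->
    win_event w <-> wins i h = n /\ (n - wins (~~ i) h = k)%N.
  move=> hw; rewrite /win_event /= /net_profit /overall_winner.
  rewrite (play_drawn _ _ _ hno ho hw); have := wn (~~ i).
  by split=> -[/eqP->]; rewrite ?eqxx; [lia|move=> <-; split => //; lia].
have [wk|wk] := pselect (wins i h = n /\ (n - wins (~~ i) h = k)%N).
  rewrite setIidl; last by move=> w /E ->.
  have [-> ->] := wk; rewrite subnn /win_prob /win_paths ltnn eqxx bin0.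
  by rewrite divr1 mule1.
rewrite (_ : _ `&` _ = set0); last first.
  by apply/seteqP; split => // w [hw]; rewrite E.
rewrite measure0 /win_prob (_ : win_paths _ _ _ = 0%N) ?mul0r ?mule0//.
move: wk ho; rewrite /win_paths /game_over; have := (wn i, wn (~~ i)).
case: ltnP => // bk [w1 w2] wk ho.
(* Since [0 < k], the opponent still has balls left here, so it is player [i] who has finished. *)
have wi : wins i h = n by move: ho bk w1 w2 => /orP[]; case: (i) => /=; lia.
rewrite wi subnn; case: eqP => // e; case: wk; split => //.
Qed.

(** Induction on the number of balls left, splitting on the type of the next ball. The condition on
    [take] excludes histories that run past the end of the game, where the draws are
    unconstrained. *)
Lemma prob_win (h : seq urnball) :
  uniq h -> all (fun b => b.2 < n)%N h ->
  ~~ game_over n (take (size h).-1 h) ->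
  P (drawn X h `&` win_event) =
  (P (drawn X h) * (win_prob k (n - wins i h) (n - wins (~~ i) h))%:E)%E.
Proof.
have [m] := ubnP (n + n - size h); elim: m h => // m IH h hm uh hn hno.
have [ho|ho] := boolP (game_over n h); first exact: win_event_over.
have step (c : bool) : P (drawn X h `&` [set w | (X (size h) w).1 = c] `&` win_event) =
    (P (drawn X h) * ((n - wins c h)%:R / (n + n - size h)%:R *
     win_prob k (n - (wins i h + (c == i)))
                (n - (wins (~~ i) h + (c == ~~ i))))%:E)%E.
  apply: prob_next => //; first exact: measurable_win_event.
  move=> j; rewrite mem_remaining//= => /andP[jh jn].
  rewrite IH ?wins_rcons//.
  (* An unfinished game has used fewer than [2n] balls, so the bound really decreases. *)
  - rewrite size_rcons; have := contra (game_over_size n h) ho.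
    by lia.
  - by rewrite rcons_uniq jh.
  - by rewrite all_rcons /= jn.
  - by rewrite size_rcons -cats1 take_size_cat.
have -> : drawn X h `&` win_event =
    drawn X h `&` [set w | (X (size h) w).1 = i] `&` win_event `|`
    drawn X h `&` [set w | (X (size h) w).1 = ~~ i] `&` win_event.
  apply/seteqP; split=> [w [hw ew]|w [|] [[]]//].
  case: (eqVneq (X (size h) w).1 i) => c; [left|right] => //.
  split => //; split => //=; move: c; case: (X _ w).1; case: (i) => //.
have mE c : measurable (drawn X h `&` [set w | (X (size h) w).1 = c] `&` win_event).
  apply: measurableI; last exact: measurable_win_event.
  rewrite (_ : _ `&` _ = \bigcup_j drawn X (rcons h (c, j))).
    by apply: bigcup_measurable => j _; exact: measurable_drawn.
  apply/seteqP; split=> [w [hw cw]|w [j _]]; rewrite ?drawn_rcons.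
    exists (X (size h) w).2 => //; rewrite drawn_rcons; split => //=.
    by rewrite -cw; case: (X _ _).
  by move=> [hw /= ->].
have disj : drawn X h `&` [set w | (X (size h) w).1 = i] `&` win_event `&`
    (drawn X h `&` [set w | (X (size h) w).1 = ~~ i] `&` win_event) = set0.
  apply/seteqP; split => // w [[[_ /= ->] _] [[_ /=]]].
  by case: (i).
have addP A B : measurable A -> measurable B -> A `&` B = set0 ->
    P (A `|` B) = (P A + P B)%E by move=> mA mB; exact: measureU.
rewrite addP//. rewrite (step i) (step (~~ i)).
have Pf : P (drawn X h) \is a fin_num.
  by apply: fin_num_measure; exact: measurable_drawn.
rewrite -(fineK Pf).
rewrite -!EFinM -EFinD -mulrDr; congr (_ * _)%:E.
have [wi wNi] : (wins i h < n)%N /\ (wins (~~ i) h < n)%N.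
  by move: ho; clear; rewrite /game_over; case: i => /=; lia.
rewrite -(winsD i h) [RHS]win_prob_drawn//; clear.
by case: i; rewrite /= !addn0 !addn1.
Qed.

Lemma prob_win_event : P win_event = (win_prob k n n)%:E.
Proof.
have g0 : ~~ game_over n [::] by rewrite /game_over /wins /= leqNgt n0.
have := prob_win [::] isT isT g0.
rewrite (_ : drawn X [::] = setT); last by apply/seteqP; split.
by rewrite setTI probability_setT mul1e !subn0.
Qed.

End one_urn.

(** * From convergence of point masses to convergence on all measurable sets *)

Section discrete_convergence.
Context {d : measure_display} {T : measurableType d} {R : realType}.
Hypothesis measurable_singleton : forall x : T, measurable [set x].

Lemma measurable_seq (s : seq T) : measurable [set` s].
Proof.
rewrite (_ : [set` s] = \bigcup_(x in [set` s]) [set x]).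
  exact: fin_bigcup_measurable.
by apply/seteqP; split=> [x xs|x [y ys ->]//]; exists x.
Qed.

Lemma probability_seq (mu : probability T R) (s : seq T) : uniq s ->
  mu [set` s] = (\sum_(x <- s) mu [set x])%E.
Proof.
move=> us; rewrite (fsbig_seq _ _ us) -measure_fin_bigcup//.
  by congr (mu _); apply/seteqP; split=> [x xs|x [y ys ->]//]; exists x.
by move=> x y _ _ [z [-> ->]].
Qed.

(** A finite set carrying almost all of the limit mass gives an asymptotic lower bound on every
    measurable set; the same bound on the complement is the upper bound. *)
Lemma cvg_probability_discrete (mu : nat -> probability T R)
    (nu : probability T R) :
  (forall e : R, 0 < e -> exists s : seq T, [/\ uniq s,
     forall x, x \in s -> mu n [set x] @[n --> \oo] --> nu [set x] &
     ((1 - e)%:E <= nu [set` s])%E]) ->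
  forall A, measurable A -> mu n A @[n --> \oo] --> nu A.
Proof.
move=> hs.
have fin (m : probability T R) B : measurable B -> m B \is a fin_num.
  by move=> mB; exact: fin_num_measure.
have lower B (e : R) : measurable B -> 0 < e ->
    \forall n \near \oo, fine (nu B) - e < fine (mu n B).
  move=> mB e0; have [|s [us cs hes]] := hs (e / 2); first by rewrite divr_gt0.
  (* Half of [e] pays for the part of [B] outside [s], the other half for the convergence on the
     finite set [sB]. *)
  pose sB := [seq x <- s | x \in B].
  have usB : uniq sB by exact: filter_uniq.
  have sBB : [set` sB] `<=` B by move=> x /=; rewrite mem_filter => /andP[/set_mem].
  have msB := measurable_seq sB.
  have cB : fine (mu n [set` sB]) @[n --> \oo] --> fine (nu [set` sB]).
    apply: fine_cvg; rewrite fineK ?fin//.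
    have E (m : probability T R) :
        m [set` sB] = (\sum_(x <- sB | x \in sB) m [set x])%E.
      by rewrite probability_seq// [LHS]big_seq.
    rewrite E (funext (fun n => E (mu n))).
    apply: cvg_nnesum => x; first by move=> _; near=> n; exact: measure_ge0.
    by rewrite mem_filter => /andP[_ /cs].
  have nuB : fine (nu B) <= fine (nu [set` sB]) + e / 2.
    have ms := measurable_seq s.
    rewrite -lee_fin EFinD !fineK ?fin//.
    rewrite (@le_trans _ _ (nu ([set` sB] `|` ~` [set` s])))//.
      rewrite le_measure ?inE//; first by apply: measurableU => //; exact: measurableC.
      move=> x Bx; have [xs|xs] := pselect (x \in s); last by right.
      by left; rewrite /= mem_filter xs andbT; exact: mem_set.
    rewrite (@le_trans _ _ (nu [set` sB] + nu (~` [set` s]))%E)//.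
      by apply: measureU2 => //; exact: measurableC.
    rewrite leeD2l// probability_setC//.
    move: hes; rewrite -(fineK (fin nu _ ms)) -EFinB !lee_fin; lra.
  have e20 : 0 < e / 2 by rewrite divr_gt0.
  move/cvgrPdist_lt: cB => /(_ _ e20) cB.
  near=> n.
  have h1 : `|fine (nu [set` sB]) - fine (mu n [set` sB])| < e / 2.
    by near: n.
  have h2 : fine (mu n [set` sB]) <= fine (mu n B).
    by rewrite fine_le ?fin// le_measure ?inE.
  move: h1; rewrite ltr_norml => /andP[_]; lra.
move=> A mA; rewrite -(fineK (fin nu A mA)); apply/fine_cvgP; split.
  by near=> n; exact: fin.
apply/cvgrPdist_lt => e e0.
have mCA := measurableC mA.
near=> n.
have h1 : fine (nu A) - e < fine (mu n A) by near: n; exact: lower.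
have h2 : fine (nu (~` A)) - e < fine (mu n (~` A)) by near: n; exact: lower.
move: h2; rewrite !probability_setC// !fineB ?fin//= => h2.
by rewrite ltr_norml; apply/andP; split; lra.
Unshelve. all: by end_near. Qed.

End discrete_convergence.

(** * The geometric law: its finite sums and its support *)

Section geometric_law.
Context {R : realType}.
Variable mu : probability R R.
Hypothesis mu_geometric : forall k : nat, (1 <= k)%N ->
  mu [set k%:R] = ((2%:R ^+ k)^-1 : R)%:E.

Definition first_naturals (K : nat) : seq R := [seq k%:R | k <- iota 1 K].

Lemma first_naturals_uniq (K : nat) : uniq (first_naturals K).
Proof. by rewrite map_inj_uniq ?iota_uniq//; exact: mulrIn. Qed.

Lemma first_naturals_gt0 (K : nat) (x : R) : x \in first_naturals K -> 0 < x.
Proof. by move=> /mapP[k + ->]; rewrite mem_iota ltr0n => /andP[]. Qed.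

Lemma geometric_first_naturals (K : nat) :
  mu [set` first_naturals K] = (1 - 2^-1 ^+ K)%:E.
Proof.
rewrite probability_seq ?first_naturals_uniq// big_map.
elim: K => [|K IH]; first by rewrite big_nil expr0 subrr.
rewrite -{1}[K.+1]addn1 iotaD big_cat big_seq1 /= {}IH.
by rewrite mu_geometric// -EFinD -exprVn exprS; congr EFin; lra.
Qed.

Lemma exists_expr_half_lt (e : R) : 0 < e -> exists K, 2^-1 ^+ K < e.
Proof.
move=> e0; have /cvgrPdist_lt/(_ _ e0) :
    (geometric 1 2^-1 n : R) @[n --> \oo] --> (0 : R).
  by apply: cvg_geometric; rewrite ger0_norm ?invr_ge0// invf_lt1 ?ltr1n.
move=> [K _ /(_ K (leqnn K))]; rewrite /= sub0r normrN mul1r => h.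
by exists K; apply: le_lt_trans h; exact: ler_norm.
Qed.

(** The masses at the positive integers already sum to 1, so a negative point lies in complements of
    arbitrarily small mass. *)
Lemma geometric_neg (x : R) : x < 0 -> mu [set x] = 0%E.
Proof.
move=> x0; apply/eqP; rewrite eq_le measure_ge0 andbT.
apply/lee_addgt0Pr => e e0; rewrite add0e.
have [K hK] := exists_expr_half_lt e e0.
have mK : measurable [set` first_naturals K] by exact: measurable_seq.
rewrite (@le_trans _ _ (mu (~` [set` first_naturals K])))//.
  rewrite le_measure ?inE//; first exact: measurableC.
  by move=> y /= -> /= /first_naturals_gt0; rewrite ltNge ltW.
rewrite probability_setC// geometric_first_naturals -EFinB lee_fin; lra.
Qed.

End geometric_law.

(** * The limit of the profit's law *)

Lemma half_mixture_oppE {d : measure_display} {T : measurableType d}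
    {R : realType} (P : probability T R) (G : {RV P >-> R}) (A : set R) :
  half_mixture (distribution P G) (distribution P (\- G : {RV P >-> R})) A =
  ((2^-1)%:E * (P (G @^-1` A) + P (G @^-1` (-%R @^-1` A))))%E.
Proof.
rewrite /half_mixture measure_addE /= /mscale /= /distribution /pushforward /=.
by rewrite ge0_muleDr.
Qed.

Theorem theorem4p1 (R : realType)
  (d : nat -> measure_display) (T : forall n : nat, measurableType (d n))
  (P : forall n : nat, probability (T n) R)
  (X : forall n : nat, nat -> {RV (P n) >-> urnball})
  (hX : forall n : nat, anti_ok_corral (X n) n)
  (i : bool)
  (d' : measure_display) (T' : measurableType d') (P' : probability T' R)
  (G : {RV P' >-> R})
  (hG : forall k : nat, (1 <= k)%N ->
    P' [set w | G w = k%:R] = ((2%:R ^+ k)^-1 : R)%:E) :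
  (forall k : nat, (1 <= k)%N ->
    P n [set w | overall_winner n (fun t => X n t w) i /\
                 net_profit n (fun t => X n t w) i = k%:Z]
      @[n --> \oo] --> ((2%:R ^+ k.+1)^-1 : R)%:E) /\
  cvg_in_distribution
    (fun n => distribution (P n) (profit (X n) n i))
    (half_mixture (distribution P' G) (distribution P' (\- G : {RV P' >-> R}))).
Proof.
(* Both players are covered: the opponent's wins give the negative values of the profit. The exact
   formula holds for [n > 0], hence eventually. *)
have win (c : bool) k : (1 <= k)%N ->
    P n (win_event (P n) (X n) n c k) @[n --> \oo] -->
    ((2%:R ^+ k.+1)^-1 : R)%:E.
  move=> k0; have winE : \forall n \near \oo,
      P n (win_event (P n) (X n) n c k) = (win_prob k n n)%:E.
    by near=> n; rewrite prob_win_event//; near: n; exact: nbhs_infty_gt.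
  apply/fine_cvgP; split; first by near=> n; rewrite (near winE n).
  apply: cvg_trans (cvg_win_prob k); apply: near_eq_cvg; near=> n.
  by rewrite /= (near winE n).
split; first exact: win.
pose nu : probability R R :=
  half_mixture (distribution P' G) (distribution P' (\- G : {RV P' >-> R})).
suff cdf A : measurable A ->
    distribution (P n) (profit (X n) n i) A @[n --> \oo] --> nu A.
  by move=> x _; exact: cdf.
pose mu : probability R R := distribution P' G.
have muG k : (1 <= k)%N -> mu [set k%:R] = ((2%:R ^+ k)^-1 : R)%:E.
  by move=> k0; rewrite -hG.
have nuE (B : set R) : nu B = ((2^-1)%:E * (mu B + mu (-%R @^-1` B)))%E.
  exact: half_mixture_oppE.
have opp1 (x : R) : -%R @^-1` [set x] = [set - x].
  by apply/seteqP; split=> y /=; [move=> <-; rewrite opprK|move=> ->; rewrite opprK].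
move: A; apply: (cvg_probability_discrete _ _ nu) => [x|e e0]; first exact: measurable_set1.
have [K hK] := exists_expr_half_lt e e0.
(* The points 1, ..., K and their opposites; their limit mass is at least [1 - 2^-K]. *)
pose s : seq R := first_naturals K ++ map -%R (first_naturals K).
exists s; split.
- rewrite cat_uniq first_naturals_uniq map_inj_uniq ?first_naturals_uniq ?andbT//=.
    apply/hasPn => _ /mapP[x /first_naturals_gt0 x0 ->].
    by apply/negP => /first_naturals_gt0; rewrite oppr_gt0 ltNge ltW.
- move=> x; rewrite mem_cat => /orP[/mapP[k]|/mapP[_ /mapP[k + ->]]];
    rewrite mem_iota => /andP[k0 _] ->; rewrite nuE opp1.
  (* At a positive integer only [G] contributes, with half of [2^-k]. *)
  + rewrite muG// (geometric_neg mu)// ?oppr_lt0 ?ltr0n// adde0 -EFinM.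
    rewrite -invfM -exprS; apply: cvg_trans (win i k k0).
    apply: near_eq_cvg; near=> n.
    by rewrite win_eventE//; near: n; exact: nbhs_infty_gt.
  (* At [- k] only [- G] contributes, and a profit of [- k] for player [i] is a profit of [k] for
     the opponent. *)
  + rewrite opprK muG// (geometric_neg mu)// ?oppr_lt0 ?ltr0n// add0e -EFinM.
    rewrite -invfM -exprS; apply: cvg_trans (win (~~ i) k k0).
    apply: near_eq_cvg; near=> n.
    have n0 : (0 < n)%N by near: n; exact: nbhs_infty_gt.
    rewrite win_eventE//; congr (P n _); apply/seteqP; split=> w;
      rewrite /= /profit net_profitN// rmorphN /=; first by move=> <-; rewrite opprK.
    by move=> ->; rewrite opprK.
- have mK : measurable [set` first_naturals K : seq R] by exact: measurable_seq.
  have ms : measurable [set` s] by exact: measurable_seq.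
  have mNs : measurable (-%R @^-1` [set` s] : set R).
    rewrite -[_ @^-1` _]setTI; exact: oppr_measurable.
  (* Both [s] and its reflection contain 1, ..., K, so each half of the mixture gives at least the
     mass of these points under [mu]. *)
  rewrite nuE; apply: (@le_trans _ _ ((2^-1)%:E *
    (mu [set` first_naturals K] + mu [set` first_naturals K]))%E).
    rewrite geometric_first_naturals// -EFinD -EFinM lee_fin; lra.
  rewrite lee_wpmul2l// leeD// le_measure ?inE// => x /= xK.
    by rewrite mem_cat xK.
  by rewrite mem_cat map_f ?orbT.
Unshelve. all: by end_near. Qed.
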